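(* There exists a function $f:\mathbb{N}\times\mathbb{N}\to\mathbb{N}$ such that for every integer $\ell\ge 0$, every integer $d\ge 0$ and every graph $G$ of distance VC-dimension $d$, the vertex set of $G$ can be covered by $f(\nu_\ell,d)$ balls of radius $\ell$; that is, $\tau_\ell\le f(\nu_\ell,d)$, where $\tau_\ell$ and $\nu_\ell$ are the transversality and the packing number of the $B_\ell$-hypergraph of $G$.
   Context: All graphs are finite and simple; $d_G$ is shortest-path distance ($+\infty$ between components) and $B_G(x,k)=\{y: d_G(x,y)\le k\}$. The $B_\ell$-hypergraph of $G=(V,E)$ has vertex set $V$ and one hyperedge $B_G(v,\ell)$ per $v\in V$; the $B$-hypergraph has hyperedges all balls $B_G(v,k)$, $v\in V$, $k\ge 0$. A set $X$ is shattered by a hypergraph if for every $X'\subseteq X$ there is a hyperedge $e$ with $e\cap X=X'$; the VC-dimension is the maximum size of a shattered set. The distance VC-dimension of $G$ is the maximum over all induced subgraphs $G'$ of $G$ of the VC-dimension of the $B$-hypergraph of $G'$. The transversality $\tau$ of a hypergraph is the minimum size of a set of vertices meeting every hyperedge; the packing number $\nu$ is the maximum number of pairwise disjoint hyperedges. (A hitting set of the $B_\ell$-hypergraph is the same as a set $X$ such that every vertex is at distance at most $\ell$ from $X$.) *)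

(* Defs.v *)
From mathcomp Require Import all_boot.

Set Implicit Arguments.
Unset Strict Implicit.
Unset Printing Implicit Defensive.

Record sgraph := SGraph {
  vertex :> finType;
  edge : rel vertex;
  edge_sym : symmetric edge;
  edge_irrefl : irreflexive edge }.

Definition induced (G : sgraph) (S : {set G}) : sgraph :=
  @SGraph {x : G | x \in S} (relpre val (@edge G))
    (fun x y => edge_sym (val x) (val y)) (fun x => edge_irrefl (val x)).

Section Distance.
Variable G : sgraph.
Implicit Types (x y : G) (k : nat).

Definition walk x y k : bool :=
  [exists p : k.-tuple G, path (@edge G) x p && (last x p == y)].

Lemma walkP x y k :
  reflect (exists p : seq G, [/\ path (@edge G) x p, last x p = y & size p = k])
          (walk x y k).
Proof.
apply: (iffP existsP) => [[p /andP[xp /eqP py]]|[p [xp py sp]]].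
  by exists p; rewrite size_tuple.
by exists (tcast sp (in_tuple p)); rewrite val_tcast /= xp py eqxx.
Qed.

Lemma connect_walk x y : connect (@edge G) x y -> exists k, walk x y k.
Proof. by case/connectP=> p xp py; exists (size p); apply/walkP; exists p. Qed.

(* [None] is the distance +oo between distinct components. *)
Definition dist x y : option nat :=
  if decP (@idP (connect (@edge G) x y)) is left xy
  then Some (ex_minn (connect_walk xy)) else None.

Definition ball x k : {set G} :=
  [set y | if dist x y is Some n then n <= k else false].

Lemma in_ball x y k :
  reflect (exists p : seq G,
             [/\ path (@edge G) x p, last x p = y & size p <= k])
          (y \in ball x k).
Proof.
rewrite inE /dist; case: decP => [xy|nxy].
  case: ex_minnP => n xy_n min_n; apply: (iffP idP) => [le_nk|].
    by case/walkP: xy_n => p [xp py sp]; exists p; rewrite sp.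
  case=> p [xp py le_pk]; apply: leq_trans le_pk.
  by apply: min_n; apply/walkP; exists p.
apply: (iffP idP) => // -[p [xp py _]].
by case: nxy; apply/connectP; exists p.
Qed.

Lemma ball_center x k : x \in ball x k.
Proof. by apply/in_ball; exists [::]. Qed.

Definition Bl_hypergraph (l : nat) : {set {set G}} := [set ball v l | v : G].

(* Radii at least #|G| only repeat earlier balls, see [B_hypergraphP]. *)
Definition B_hypergraph : {set {set G}} :=
  [set ball v (val k) | v : G, k : 'I_#|G|].

Lemma B_hypergraphP (e : {set G}) :
  reflect (exists v k, e = ball v k) (e \in B_hypergraph).
Proof.
apply: (iffP imset2P) => [[v k _ _ ->]|[v [k ->]]]; first by exists v, k.
have G_gt0 : 0 < #|G| by apply/card_gt0P; exists v.
have lt_k : minn k #|G|.-1 < #|G| by rewrite -[ltnRHS]prednK // ltnS geq_minr.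
exists v (Ordinal lt_k) => //; apply/setP=> y /=.
apply/in_ball/in_ball => -[p [vp py le_p]]; last first.
  by exists p; split=> //; apply: leq_trans le_p _; apply: geq_minl.
case/shortenP: vp py => q vq uq sqp qy; exists q; split=> //.
have lt_q : size q < #|G| by rewrite -[_.+1](card_uniqP uq) max_card.
have le_qp : size q <= size p.
  by apply: uniq_leq_size => //; case/andP: uq.
by rewrite leq_min (leq_trans le_qp le_p) -ltnS prednK.
Qed.

End Distance.

Section Hypergraph.
Variables (V : finType) (H : {set {set V}}).

Definition shattered (X : {set V}) : bool :=
  [forall Y : {set V}, (Y \subset X) ==> [exists e in H, e :&: X == Y]].

Definition VC_dim : nat := \max_(X : {set V} | shattered X) #|X|.

Definition hitting (X : {set V}) : bool :=
  [forall e in H, e :&: X != set0].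

(* Meaningful when no hyperedge is empty, which is the case for balls:
   [setT] is then a hitting set. *)
Definition transversality : nat :=
  #|[arg min_(X < [set: V] | hitting X) #|X|]|.

Definition packing_number : nat :=
  \max_(P : {set {set V}} | (P \subset H) && trivIset P) #|P|.

End Hypergraph.

(* The null graph has no ball, hence no shattered set at all; it is given
   VC-dimension 0 by the convention that an empty maximum is 0. *)
Definition distance_VC_dim (G : sgraph) : nat :=
  \max_(S : {set G}) VC_dim (B_hypergraph (induced S)).

Definition tau (G : sgraph) (l : nat) : nat :=
  transversality (Bl_hypergraph G l).

Definition nu (G : sgraph) (l : nat) : nat :=
  packing_number (Bl_hypergraph G l).

Lemma hitting_Bl_setT (G : sgraph) l : hitting (Bl_hypergraph G l) [set: G].
Proof.
apply/forall_inP=> _ /imsetP[v _ ->]; rewrite setIT.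
by apply/set0Pn; exists v; apply: ball_center.
Qed.

(* Main.v *)
(** If every pair of a large set of balls meets, join their centres by geodesics.
    When the middle vertices of each geodesic lie in none of the other balls
    ("private"), distances inside a union of geodesics reveal which pairs were
    joined, so suitable unions shatter large sets of centres.  Hence, by Ramsey,
    with bounded packing number and bounded distance VC-dimension there is no
    large family of centres with private middles.  If every vertex were within
    distance l of only a small fraction of a weighted vertex set, a random sample
    of that set would have private middles; so every weighting has a vertex whose
    ball carries a constant fraction of the weight.  Multiplicative weights turn
    this into a sequence of vertices of which every ball contains a constant
    fraction (this replaces LP duality), and an epsilon-net argument extracts a
    hitting set of bounded size. *)
Require Import Defs.
From mathcomp Require Import all_boot zify.

Set Implicit Arguments.
Unset Strict Implicit.
Unset Printing Implicit Defensive.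

(** * Finite combinatorics *)

Section Resampling.
Variables (I W : finType).
Implicit Types (f : {ffun I -> W}) (m : I) (w : W).

Definition update f m w : {ffun I -> W} :=
  [ffun i => if i == m then w else f i].

Lemma update_same f m w : update f m w m = w.
Proof. by rewrite ffunE eqxx. Qed.

Lemma update_other f m w i : i != m -> update f m w i = f i.
Proof. by rewrite ffunE => /negPf->. Qed.

Lemma card_resample m (E : pred {ffun I -> W}) b :
  (forall f, b * #|[pred w | E (update f m w)]| <= #|W|) ->
  b * #|E| <= #|{ffun I -> W}|.
Proof.
move=> bE; have [f0 _|no_f] := pickP E; last by rewrite (eq_card0 no_f) muln0.
have W_gt0 : 0 < #|W| by apply/card_gt0P; exists (f0 m).
have swapK : involutive (fun p : {ffun I -> W} * W => (update p.1 m p.2, p.1 m)).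
  case=> f w /=; rewrite update_same; congr (_, _); apply/ffunP=> i.
  by rewrite !ffunE; case: eqP => // ->.
have sumE : \sum_f #|[pred w | E (update f m w)]| = #|W| * #|E|.
  pose F (p : {ffun I -> W} * W) := nat_of_bool (E p.1).
  transitivity (\sum_p F (update p.1 m p.2, p.1 m)).
    rewrite -(pair_bigA _ (fun f w => F (update f m w, f m))) /=.
    by apply: eq_bigr => f _; rewrite -sum1_card big_mkcond.
  rewrite -(reindex_inj (h := fun p => (update p.1 m p.2, p.1 m))
    (P := xpredT) (F := F) (inv_inj swapK)).
  rewrite -(pair_bigA _ (fun f w => F (f, w))) /=.
  rewrite -[#|E|]sum1_card [in RHS]big_mkcond.
  rewrite big_distrr; apply: eq_bigr => f _.
  by rewrite -[RHS]sum_nat_const.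
rewrite -(leq_pmul2l W_gt0) mulnCA -sumE big_distrr /= mulnC -sum_nat_const.
exact: leq_sum.
Qed.

Lemma resampling (J : finType) (E : J -> pred {ffun I -> W}) (coord : J -> I) b :
  0 < #|W| -> #|J| < b ->
  (forall j f, b * #|[pred w | E j (update f (coord j) w)]| <= #|W|) ->
  exists f, forall j, ~~ E j f.
Proof.
move=> W_gt0 ltJb bE.
have [/existsP[f /forallP]|] := boolP [exists f, [forall j, ~~ E j f]].
  by exists f.
rewrite negb_exists => /forallP allbad; exfalso.
have F_gt0 : 0 < #|{ffun I -> W}| by rewrite card_ffun expn_gt0 W_gt0.
have: b * #|{ffun I -> W}| <= #|J| * #|{ffun I -> W}|.
  apply: (@leq_trans (b * \sum_(j : J) #|E j|)); last first.
    rewrite big_distrr -sum_nat_const; apply: leq_sum => j _.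
    exact: card_resample (bE j).
  rewrite leq_mul2l; apply/orP; right.
  under [leqRHS]eq_bigr do rewrite -sum1_card big_mkcond.
  rewrite exchange_big -sum1_card; apply: leq_sum => f _ /=.
  have := allbad f; rewrite negb_forall => /existsP[j]; rewrite negbK => Ejf.
  by rewrite (bigD1 j) //= unfold_in Ejf.
by rewrite leq_pmul2r // leqNgt ltJb.
Qed.

End Resampling.

Lemma ramsey (T : finType) (e : rel T) k m (A : {set T}) :
  symmetric e -> 2 ^ (k + m) <= #|A| ->
  exists2 B : {set T}, B \subset A &
    (#|B| = k /\ {in B &, forall x y, x != y -> e x y}) \/
    (#|B| = m /\ {in B &, forall x y, x != y -> ~~ e x y}).
Proof.
move=> e_sym; have [n] := ubnP (k + m); elim: n => // n IHn in k m A *.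
case: k => [|k] lt_n leA.
  by exists set0; [apply: sub0set | left; rewrite cards0; split=> // x y; rewrite inE].
case: m => [|m] in lt_n leA *.
  by exists set0; [apply: sub0set | right; rewrite cards0; split=> // x y; rewrite inE].
have /card_gt0P[x Ax] : 0 < #|A| by apply: leq_trans leA; rewrite expn_gt0.
pose N := [set y in A :\ x | e x y]; pose M := [set y in A :\ x | ~~ e x y].
have NM : (#|N| + #|M|).+1 = #|A|.
  rewrite (cardsD1 x A) Ax; congr _.+1; rewrite -cardsUI.
  rewrite [X in _ + #|pred_of_set X|](_ : _ = set0) ?cards0 ?addn0.
    by apply: eq_card => y; rewrite !inE; case: (e x y); rewrite ?andbT ?andbF ?orbF.
  by apply/setP=> y; rewrite !inE; case: (e x y); rewrite ?andbF.
have [leN|ltN] := leqP (2 ^ (k + m.+1)) #|N|.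
  have [||B BN [[cB hB]|hB]] := IHn k m.+1 N => //.
  - have BA : B \subset A.
      by apply: subset_trans BN _; apply/subsetP=> y; rewrite !inE => /andP[/andP[]].
    have xB : x \notin B.
      by apply: contraTN isT => /(subsetP BN); rewrite !inE eqxx.
    exists (x |: B); first by rewrite subUset sub1set Ax.
    left; rewrite cardsU1 xB cB; split=> // y z; rewrite !inE.
    case: (eqVneq y x) => [->|_]; case: (eqVneq z x) => [->|_] //=; rewrite ?eqxx //.
    + by move=> _ /(subsetP BN); rewrite !inE => /andP[_ ->].
    + by move=> /(subsetP BN); rewrite !inE e_sym => /andP[_ ->].
    + exact: hB.
  - exists B; last by right.
    by apply: subset_trans BN _; apply/subsetP=> y; rewrite !inE => /andP[/andP[]].
have leM : 2 ^ (k.+1 + m) <= #|M|.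
  have : 2 ^ (k.+1 + m.+1) = 2 ^ (k + m.+1) + 2 ^ (k.+1 + m).
    by rewrite !addSn addnS !expnS; lia.
  by lia.
have [||B BM [hB|[cB hB]]] := IHn k.+1 m M => //; first by rewrite -addnS.
- exists B; last by left.
  by apply: subset_trans BM _; apply/subsetP=> y; rewrite !inE => /andP[/andP[]].
- have BA : B \subset A.
    by apply: subset_trans BM _; apply/subsetP=> y; rewrite !inE => /andP[/andP[]].
  have xB : x \notin B.
    by apply: contraTN isT => /(subsetP BM); rewrite !inE eqxx.
  exists (x |: B); first by rewrite subUset sub1set Ax.
  right; rewrite cardsU1 xB cB; split=> // y z; rewrite !inE.
  case: (eqVneq y x) => [->|_]; case: (eqVneq z x) => [->|_] //=; rewrite ?eqxx //.
  + by move=> _ /(subsetP BM); rewrite !inE => /andP[_ ->].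
  + by move=> /(subsetP BM); rewrite !inE e_sym => /andP[_ ->].
  + exact: hB.
Qed.

Section Pajor.
Variable V : finType.
Implicit Types (H : {set {set V}}) (X : {set V}).

Lemma shatteredP H X :
  reflect (forall Y : {set V}, Y \subset X -> exists2 e, e \in H & e :&: X = Y)
          (shattered H X).
Proof.
apply: (iffP forall_inP) => [shX Y /shX/exists_inP[e eH /eqP eX]|shX Y /shX[e eH eX]].
  by exists e.
by apply/exists_inP; exists e => //; apply/eqP.
Qed.

Lemma shattered_sub H1 H2 X : H1 \subset H2 -> shattered H1 X -> shattered H2 X.
Proof.
move=> sH /shatteredP shX; apply/shatteredP => Y /shX[e /(subsetP sH) eH eX].
by exists e.
Qed.

(* Split H by an element x that separates two hyperedges: a set shattered by
   both halves avoids x and stays shattered by H when x is added. *)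
Lemma pajor H : #|H| <= #|[set X | shattered H X]|.
Proof.
have [n] := ubnP #|H|; elim: n => // n IHn in H *; rewrite ltnS => leHn.
have [|H_gt1] := leqP #|H| 1.
  case: (posnP #|H|) => [->|/card_gt0P[e eH]] //; move/leq_trans; apply.
  apply/card_gt0P; exists set0; rewrite inE; apply/shatteredP => Y.
  by rewrite subset0 => /eqP->; exists e; rewrite ?setI0.
have [e1 [e2 [e1H e2H ne12]]] := card_gt1P H_gt1.
have [x xe] : exists x, (x \in e1) != (x \in e2).
  apply/existsP; apply: contraNT ne12; rewrite negb_exists => /forallP h.
  by apply/eqP/setP=> x; apply/eqP; have := h x; rewrite negbK.
pose H1 := [set e in H | x \in e]; pose H0 := [set e in H | x \notin e].
have cH : #|H| = #|H1| + #|H0|.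
  rewrite -cardsUI [X in _ + #|pred_of_set X|](_ : _ = set0) ?cards0 ?addn0.
    by apply: eq_card => e; rewrite !inE; case: (x \in e); rewrite ?andbT ?andbF ?orbF.
  by apply/setP=> e; rewrite !inE; case: (x \in e); rewrite ?andbF.
have [H1_gt0 H0_gt0] : 0 < #|H1| /\ 0 < #|H0|.
  by split; apply/card_gt0P; move: xe; case xe1: (x \in e1); case xe2: (x \in e2) => // _;
    [exists e1 | exists e2 | exists e2 | exists e1]; rewrite inE ?e1H ?e2H ?xe1 ?xe2.
pose S (K : {set {set V}}) := [set X | shattered K X].
have noncontain b (K : {set {set V}}) X :
    (forall e, e \in K -> (x \in e) = b) -> X \in S K -> x \notin X.
  move=> Kb; rewrite inE => /shatteredP shX; apply/negP=> xX.
  have [] := shX (if b then set0 else X); first by case: b {Kb}; rewrite ?sub0set.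
  by move=> e eK /setP/(_ x); rewrite !inE (Kb e eK) xX; case: b {Kb}; rewrite ?inE ?xX.
have S1 X : X \in S H1 -> x \notin X.
  by apply: (noncontain true) => e; rewrite inE => /andP[].
have S0 X : X \in S H0 -> x \notin X.
  by apply: (noncontain false) => e; rewrite inE => /andP[_ /negPf].
rewrite cH; apply: (@leq_trans (#|S H1| + #|S H0|)).
  by apply: leq_add; apply: IHn; lia.
rewrite -cardsUI.
rewrite -(card_in_imset (f := fun X => x |: X) (D := S H1 :&: S H0)); last first.
  move=> X Y; rewrite !(in_setI, in_setU) => /andP[/S1 xX _] /andP[/S1 xY _] eXY.
  by rewrite -(setU1K xX) eXY setU1K.
rewrite -cardsUI [X in _ + #|pred_of_set X| <= _](_ : _ = set0) ?cards0 ?addn0; last first.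
  apply/setP=> X; rewrite !in_setI in_setU in_set0; apply/negP=> /andP[SX /imsetP[Y _ eX]].
  by case/orP: SX => [/S1|/S0]; rewrite eX !inE eqxx.
apply/subset_leq_card/subsetP=> X; rewrite !in_setU => /orP[/orP[]|/imsetP[Y + ->]].
- by rewrite !inE; apply: shattered_sub; apply/subsetP=> e; rewrite inE => /andP[].
- by rewrite !inE; apply: shattered_sub; apply/subsetP=> e; rewrite inE => /andP[].
rewrite in_setI => /andP[S1Y S0Y]; have xY := S1 _ S1Y.
rewrite !inE in S1Y S0Y *; apply/shatteredP => Z sZ.
have sZ' : Z :\ x \subset Y by rewrite subDset.
have [xZ|xZ] := boolP (x \in Z).
  have [e + eY] := shatteredP _ _ S1Y _ sZ'; rewrite inE => /andP[eH xe'].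
  exists e => //; apply/setP=> y; move/setP/(_ y): eY; rewrite !inE.
  by case: (eqVneq y x) => [->|] //=; rewrite xe' xZ.
have [e + eY] := shatteredP _ _ S0Y _ sZ'; rewrite inE => /andP[eH xe'].
exists e => //; apply/setP=> y; move/setP/(_ y): eY; rewrite !inE.
by case: (eqVneq y x) => [->|] //=; rewrite (negPf xe') (negPf xZ).
Qed.

Lemma card_small_sets d : #|[set X : {set V} | #|X| <= d]| <= #|V|.+1 ^ d.
Proof.
rewrite -[in X in _ ^ X](card_ord d) -card_option -card_ffun.
pose F (f : {ffun 'I_d -> option V}) := [set y | Some y \in codom f].
apply: leq_trans (leq_imset_card F _); rewrite ?cardsT //.
apply/subset_leq_card/subsetP=> X; rewrite inE => leXd; apply/imsetP.
exists [ffun i : 'I_d => nth None (map Some (enum X)) i] => //.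
apply/setP=> y; rewrite inE; apply/idP/codomP => [yX|[i]].
  have lt_i : index y (enum X) < d.
    by apply: leq_trans leXd; rewrite cardE index_mem mem_enum.
  exists (Ordinal lt_i); rewrite ffunE /= (nth_map y) ?nth_index ?index_mem ?mem_enum //.
rewrite ffunE => h; have: Some y \in map Some (enum X).
  rewrite h; apply: mem_nth; rewrite ltnNge; apply/negP=> le.
  by rewrite nth_default in h.
by rewrite mem_map ?mem_enum // => ? ? [].
Qed.

End Pajor.

(** * Balls and geodesics *)

Section Balls.
Variable G : sgraph.
Implicit Types (x y z u v : G) (k t : nat) (p : seq G).

Lemma ball_sym x y k : (y \in ball x k) = (x \in ball y k).
Proof.
wlog suff sub : x y / x \in ball y k -> y \in ball x k.
  by apply/idP/idP; apply: sub.
case/in_ball=> p [yp <- le_p]; apply/in_ball; exists (rev (belast y p)).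
split; last by rewrite size_rev size_belast.
  by rewrite rev_path; under eq_path do rewrite edge_sym.
by case: p {yp le_p} => //= z p; rewrite rev_cons last_rcons.
Qed.

Lemma ball_trans y x z k t : y \in ball x k -> z \in ball y t -> z \in ball x (k + t).
Proof.
case/in_ball=> p [xp <- le_p] /in_ball[q [yq <- le_q]]; apply/in_ball.
by exists (p ++ q); rewrite cat_path xp yq last_cat size_cat leq_add.
Qed.

Lemma ball_le x y k t : k <= t -> y \in ball x k -> y \in ball x t.
Proof.
move=> le_kt /in_ball[p [xp py le_p]]; apply/in_ball; exists p.
by rewrite (leq_trans le_p).
Qed.

(* The t-th vertex of the walk x :: p, constantly its last one past the end. *)
Definition walk_at x p t := last x (take t p).

Lemma walk_at_size x p : walk_at x p (size p) = last x p.
Proof. by rewrite /walk_at take_size. Qed.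

Lemma walk_at_ball x p s t :
  path (@edge G) x p -> s <= t -> walk_at x p t \in ball (walk_at x p s) (t - s).
Proof.
move=> xp le_st; apply/in_ball; exists (drop s (take t p)).
have eq_s : take s (take t p) = take s p by rewrite take_takel.
have xpt : path (@edge G) x (take t p).
  by rewrite -[p](cat_take_drop t) cat_path in xp; case/andP: xp.
rewrite -[take t p](cat_take_drop s) eq_s cat_path in xpt.
have [_ ->] := andP xpt; split=> //.
  by rewrite /walk_at -[in RHS](cat_take_drop s (take t p)) eq_s last_cat.
by rewrite size_drop size_take leq_sub2r //; case: ltnP.
Qed.

Lemma walk_at_mem x p t : walk_at x p t \in x :: p.
Proof.
have := mem_last x (take t p); rewrite !inE => /orP[->//|/mem_take ->].
by rewrite orbT.
Qed.

Lemma path_switch (P Q : G -> Prop) x p :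
  path (@edge G) x p -> P x -> Q (last x p) ->
  (forall y, y \in x :: p -> P y \/ Q y) ->
  exists t s, [/\ t <= size p, s <= size p, P (walk_at x p t), Q (walk_at x p s)
    & walk_at x p s \in ball (walk_at x p t) 1].
Proof.
elim: p x => [|y p IHp] x /=.
  by move=> _ Px Qx _; exists 0, 0; split=> //; apply: ball_center.
case/andP=> xy yp Px Qp PQ.
have [Py|Qy] : P y \/ Q y by apply: PQ; rewrite !inE eqxx orbT.
  have [|t [s [le_t le_s Pt Qs ts]]] := IHp y yp Py Qp.
    by move=> z zp; apply: PQ; rewrite inE zp orbT.
  by exists t.+1, s.+1.
exists 0, 1; split=> //=; first by rewrite /walk_at /= take0.
by apply/in_ball; exists [:: y]; rewrite /walk_at /= take0 xy.
Qed.

(* Junk value 0 between distinct components. *)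
Definition gdist x y := odflt 0 (dist x y).

Definition geodesic x y : seq G :=
  if [pick p : (gdist x y).-tuple G | path (@edge G) x p && (last x p == y)] is Some p
  then p else [::].

Lemma gdist_ball x y k : y \in ball x k -> gdist x y <= k /\ y \in ball x (gdist x y).
Proof. by rewrite /gdist !inE; case: (dist x y). Qed.

Lemma geodesicP x y k : y \in ball x k ->
  [/\ path (@edge G) x (geodesic x y), last x (geodesic x y) = y
    & size (geodesic x y) = gdist x y].
Proof.
case/gdist_ball=> _ /in_ball[p [xp py le_p]].
have szp : size p = gdist x y.
  have /gdist_ball[] : y \in ball x (size p) by apply/in_ball; exists p.
  by move=> le _; apply/eqP; rewrite eqn_leq le_p le.
rewrite /geodesic; case: pickP => [q /andP[xq /eqP qy]|no].
  by rewrite size_tuple.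
by have := no (tcast szp (in_tuple p)); rewrite val_tcast /= xp py eqxx.
Qed.

Lemma gdistC x y k : y \in ball x k -> gdist x y = gdist y x.
Proof.
move=> yx; have xy : x \in ball y k by rewrite ball_sym.
have [_ h1] := gdist_ball yx; have [_ h2] := gdist_ball xy.
apply/eqP; rewrite eqn_leq; apply/andP.
by split; [rewrite ball_sym in h2 | rewrite ball_sym in h1]; 
  [case: (gdist_ball h2) | case: (gdist_ball h1)].
Qed.

Definition lower_mid x y := walk_at x (geodesic x y) (gdist x y)./2.
Definition upper_mid x y := walk_at x (geodesic x y) (uphalf (gdist x y)).

End Balls.

Lemma in_ball_induced (G : sgraph) (S : {set G}) (x y : induced S) k :
  reflect (exists p, [/\ path (@edge G) (val x) p, last (val x) p = val y,
                        size p <= k & {subset p <= S}])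
          (y \in ball x k).
Proof.
apply: (iffP (in_ball x y k)) => [[p [xp py le_p]]|[p [xp py le_p sp]]].
  exists (map val p); split.
  - by rewrite path_map.
  - by rewrite last_map py.
  - by rewrite size_map.
  - by move=> _ /mapP[u _ ->]; apply: valP.
have: exists q : seq (induced S), p = map val q.
  elim: p sp {xp py le_p} => [|u p IHp] sp; first by exists [::].
  have [|q ->] := IHp; first by move=> v vp; apply: sp; rewrite inE vp orbT.
  have uS : u \in S by apply: sp; rewrite mem_head.
  by exists (Sub u uS :: q).
case=> q eq_p; exists q; rewrite eq_p in xp py le_p.
split; first by rewrite path_map in xp.
- by apply: val_inj; rewrite -py last_map.
- by rewrite size_map in le_p.
Qed.

Lemma leq_distance_VC_dim (G : sgraph) (S A : {set G}) : A \subset S ->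
  (forall Y : {set G}, Y \subset A -> exists v k, v \in S /\ forall a, a \in A ->
     ((exists p, [/\ path (@edge G) v p, last v p = a, size p <= k & {subset p <= S}])
       <-> a \in Y)) ->
  #|A| <= distance_VC_dim G.
Proof.
move=> sAS shA; pose A' : {set induced S} := [set a | val a \in A].
have valA' : val @: A' = A.
  apply/setP=> a; apply/imsetP/idP => [[b + ->]|aA]; first by rewrite inE.
  by exists (Sub a (subsetP sAS a aA)); rewrite ?inE.
rewrite -valA' card_imset; last exact: val_inj.
apply: leq_trans (leq_bigmax (F := fun S => VC_dim (B_hypergraph (induced S))) S).
apply: (@leq_bigmax_cond _ (shattered (B_hypergraph (induced S))) (fun X => #|X|)).
apply/shatteredP => Y sY.
have [|v [k [vS hv]]] := shA (val @: Y); first by rewrite -valA' imsetS.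
exists (ball (Sub v vS : induced S) k); first by apply/B_hypergraphP; exists (Sub v vS), k.
apply/setP=> a; rewrite inE; have [aA|aA] := boolP (a \in A'); last first.
  by rewrite andbF; apply/esym/negbTE; apply: contra aA; apply/subsetP.
rewrite andbT; have := hv (val a); rewrite inE in aA => /(_ aA) h.
rewrite (mem_imset _ _ val_inj) in h.
by apply/idP/idP => [/in_ball_induced|aY]; [move/h | apply/in_ball_induced/h].
Qed.

Lemma leq_distance_VC_dim_ball (G : sgraph) (A : {set G}) l :
  (forall Y : {set G}, Y \subset A -> exists v,
     forall a, a \in A -> (a \in ball v l) = (a \in Y)) ->
  #|A| <= distance_VC_dim G.
Proof.
move=> shA; apply: (@leq_distance_VC_dim G [set: G]); first exact: subsetT.
move=> Y /shA[v hv]; exists v, l; split=> [|a aA]; first by rewrite inE.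
rewrite -(hv a aA); split=> [[p [vp pa le_p _]]|/in_ball[p [vp pa le_p]]].
  by apply/in_ball; exists p.
by exists p; split=> // b _; rewrite inE.
Qed.

(** * Shattering by unions of geodesics *)

Definition private_mids (G : sgraph) (I : finType) (x : I -> G) (l : nat) :=
  forall a b m, m != a -> m != b ->
    x m \notin ball (lower_mid (x a) (x b)) l /\ x m \notin ball (upper_mid (x a) (x b)) l.

Section Spokes.
Variables (G : sgraph) (l : nat) (I : finType) (x : I -> G).
Hypothesis x_near : forall a b, x b \in ball (x a) l.*2.
Hypothesis x_mids : private_mids x l.
Implicit Types (a b c d m : I) (u v w : G) (s k t : nat).

Local Notation L a b := (gdist (x a) (x b)).

Lemma gdist_min a b k : x b \in ball (x a) k -> L a b <= k.
Proof. by case/gdist_ball. Qed.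

Lemma gdist_diag a : L a a = 0.
Proof. by apply/eqP; rewrite -leqn0 gdist_min ?ball_center. Qed.

Lemma x_separated a m : m != a -> x m \notin ball (x a) l.
Proof.
move=> ne; have [] := x_mids ne ne.
by rewrite /lower_mid gdist_diag /walk_at /= take0.
Qed.

Lemma gdist_gt a b : a != b -> l < L a b.
Proof.
rewrite eq_sym => /x_separated; apply: contraR; rewrite -leqNgt => le.
by have [_] := gdist_ball (x_near a b); apply: ball_le.
Qed.

(* u lies at level s on the a-half of the a-b geodesic; the last clause is what
   remains of the privacy of its middle vertex on that side. *)
Definition spoke a b u s :=
  [/\ s <= (L a b)./2, u \in ball (x a) s, x b \in ball u (L a b - s)
    & forall m k, m != a -> m != b -> x m \in ball u k -> l + s < k + (L a b)./2].

Lemma spoke_geodesic a b t : t <= L a b ->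
  exists s, let u := walk_at (x a) (geodesic (x a) (x b)) t in
    spoke a b u s \/ spoke b a u s.
Proof.
move=> le_t; have [pth lst sz] := geodesicP (x_near a b).
set p := geodesic _ _ in pth lst sz *.
have u_a : walk_at (x a) p t \in ball (x a) t.
  by have := walk_at_ball pth (leq0n t); rewrite subn0 /walk_at take0.
have b_u : x b \in ball (walk_at (x a) p t) (L a b - t).
  by have := walk_at_ball pth le_t; rewrite -{1}sz walk_at_size lst.
have [le_th|lt_ht] := leqP t (L a b)./2.
  exists t; left; split=> // m k ma mb mu; rewrite ltnNge; apply/negP=> le.
  have [/negP nm _] := x_mids ma mb; apply: nm.
  apply: (@ball_le _ _ _ (((L a b)./2 - t) + k)); first by lia.
  by apply: ball_trans mu; rewrite ball_sym; apply: walk_at_ball.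
have LC := gdistC (x_near a b).
exists (L a b - t); right; split; rewrite -?LC //; first by lia.
- by rewrite ball_sym.
- by rewrite ball_sym subKn.
move=> m k mb ma mu; rewrite ltnNge; apply/negP=> le.
have [_ /negP nm] := x_mids ma mb; apply: nm.
apply: (@ball_le _ _ _ ((t - uphalf (L a b)) + k)); first by lia.
by apply: ball_trans mu; apply: walk_at_ball => //; lia.
Qed.

Lemma spoke_owner_far a b u s k : spoke a b u s -> x b \in ball u k -> L a b <= s + k.
Proof. by case=> _ ua _ _ bu; exact: gdist_min (ball_trans ua bu). Qed.

Lemma spoke_center a b c s : spoke a b (x c) s -> a = c.
Proof.
move=> sp; have [le_s _ _ priv] := sp.
apply/eqP; apply: contraT => ac; have cc := ball_center (x c) 0.
have [bc|bc] := eqVneq b c.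
  by rewrite bc in sp le_s *; have := spoke_owner_far sp cc; have := gdist_gt ac; lia.
rewrite eq_sym in ac; rewrite eq_sym in bc; have := priv c 0 ac bc cc.
by have := gdist_min (x_near a b); lia.
Qed.

Definition far_from_others a c v :=
  forall m k, m != a -> m != c -> x m \in ball v k -> l < k.

Lemma spoke_top a b u s : spoke a b u s -> s = (L a b)./2 -> far_from_others a b u.
Proof. by case=> _ _ _ priv eqs m k ma mb /(priv m k ma mb); lia. Qed.

(* Privacy at both ends forces an edge between an a-half and a c-half to run along
   the a-c geodesic, where it has to reach a middle vertex. *)
Lemma spoke_crossing a b c d u w s t :
  (forall a b, a != b -> L a b < l.*2) ->
  spoke a b u s -> spoke c d w t -> w \in ball u 1 -> a != c ->
  (b = c \/ d = a) /\ (far_from_others a c u \/ far_from_others a c w).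
Proof.
move=> ltL sa sc uw ac; have wu : u \in ball w 1 by rewrite ball_sym.
have [le_s ua bu priv_u] := sa; have [le_t wc dw priv_w] := sc.
have half_lt e f : (L e f)./2 < l.
  have l_gt0 : 0 < l by move: (ltL _ _ ac); clear; lia.
  have [->|/ltL] := eqVneq e f; first by rewrite gdist_diag.
  by clear; lia.
have aw : x a \in ball w (1 + s) by apply: ball_trans wu _; rewrite ball_sym.
have cu : x c \in ball u (1 + t) by apply: ball_trans uw _; rewrite ball_sym.
have ca : c != a by rewrite eq_sym.
have lt_ts : a != d -> t < s.
  by move=> ad; move: (priv_w a _ ac ad aw) (half_lt c d); clear; lia.
have lt_st : c != b -> s < t.
  by move=> cb; move: (priv_u c _ ca cb cu) (half_lt a b); clear; lia.
have swap v : far_from_others c a v -> far_from_others a c v.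
  by move=> h m k ma mc; apply: h.
have [bc|bc] := eqVneq b c; have [da|da] := eqVneq d a.
- split; first by left.
  subst b d; have := spoke_owner_far sa cu.
  have LC := gdistC (x_near a c); rewrite -LC in le_t.
  have [eqs _|nes leL] := eqVneq s (L a c)./2; first by left; apply: spoke_top sa eqs.
  right; apply/swap/(spoke_top sc); rewrite -LC; move/eqP: nes leL le_s le_t; clear; lia.
- split; [by left | left]; subst b.
  rewrite eq_sym in da; apply: (spoke_top sa).
  by move: (spoke_owner_far sa cu) (lt_ts da) le_s; clear; lia.
- split; [by right | right]; subst d; rewrite eq_sym in bc.
  apply/swap/(spoke_top sc).
  by move: (spoke_owner_far sc aw) (lt_st bc) le_t; clear; lia.
- exfalso; rewrite eq_sym in bc; rewrite eq_sym in da.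
  by move: (lt_ts da) (lt_st bc); clear; lia.
Qed.

End Spokes.

Section Shattering.
Variables (G : sgraph) (l n : nat) (x : 'I_n + {set 'I_n} -> G).
Hypothesis x_near : forall a b, x b \in ball (x a) l.*2.
Hypothesis x_mids : private_mids x l.
Hypothesis x_dist : (forall a b, a != b -> gdist (x a) (x b) = l.*2) \/
  (forall a b, a != b -> gdist (x a) (x b) < l.*2).

(* Diagonal pairs are included so that every centre lies on a geodesic. *)
Let rel_in (a b : 'I_n + {set 'I_n}) : bool :=
  match a, b with inr Z, inl i => i \in Z | _, _ => a == b end.

Let linked a b := rel_in a b || rel_in b a.

(* In the induced subgraph on S, the ball of radius 2l around the centre indexed
   by Z meets the centres indexed by 'I_n exactly in those of Z. *)
Let S : {set G} := [set u | [exists a, exists b, rel_in a b &&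
  [exists t : 'I_(gdist (x a) (x b)).+1, u == walk_at (x a) (geodesic (x a) (x b)) t]]].

Lemma S_spoke u : u \in S -> exists a b s, linked a b /\ spoke l x a b u s.
Proof.
rewrite inE => /existsP[a /existsP[b /andP[ab /existsP[t /eqP->]]]].
have [s [sp|sp]] := spoke_geodesic x_near x_mids (ltn_ord t : t <= _).
  by exists a, b, s; rewrite /linked ab.
by exists b, a, s; rewrite /linked ab orbT.
Qed.

Lemma S_center a : x a \in S.
Proof.
rewrite inE; apply/existsP; exists a; apply/existsP; exists a.
have -> : rel_in a a by case: a => ? /=.
by apply/existsP; exists ord0; rewrite /walk_at take0.
Qed.

Lemma S_far (Z : {set 'I_n}) (i : 'I_n) p : i \notin Z ->
  path (@edge G) (x (inr Z)) p -> last (x (inr Z)) p = x (inl i) ->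
  size p <= l.*2 -> {subset p <= S} -> False.
Proof.
move=> iZ pth lst le_p pS; set z := inr Z : 'I_n + {set 'I_n} in pth lst *.
set y := inl i : 'I_n + {set 'I_n} in lst *.
have xpS u : u \in x z :: p -> u \in S.
  by rewrite inE => /predU1P[->|/pS //]; apply: S_center.
have z_t t : x z \in ball (walk_at (x z) p t) t.
  by rewrite ball_sym; have := walk_at_ball pth (leq0n t); rewrite subn0 /walk_at take0.
have y_t t : t <= size p -> x y \in ball (walk_at (x z) p t) (size p - t).
  by move=> le_t; have := walk_at_ball pth le_t; rewrite walk_at_size lst.
have ne_zy : z != y by [].
have nlinked a b : linked a b -> (z != a) && (z != b) || (y != a) && (y != b).
  apply: contraLR; rewrite negb_or !negb_and !negbK.
  have zy : ~~ linked z y by rewrite /linked /= negb_or iZ.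
  have yz : ~~ linked y z by rewrite /linked orbC.
  by case/andP=> /orP[]/eqP<- /orP[]/eqP eq; rewrite -?eq // in ne_zy *.
have [allL|ltL] := x_dist.
  (* The walk is then a shortest path of G, and its midpoint is too close to a
     third centre. *)
  have le_l : l.*2 <= size p.
    rewrite -(allL z y ne_zy) gdist_min // ball_sym.
    by have := z_t (size p); rewrite walk_at_size lst.
  have size_p : size p = l.*2 by lia.
  have zm := z_t l; have ym : x y \in ball (walk_at (x z) p l) l.
    by have := @y_t l; rewrite size_p -addnn addnK; apply; lia.
  have [a [b [s [ab [le_s am _ priv]]]]] := S_spoke (xpS _ (walk_at_mem _ p l)).
  have absurd c : c != a -> c != b -> x c \in ball (walk_at (x z) p l) l -> False.
    move=> ca cb cm; move: (priv c l ca cb cm) (gdist_min (ball_trans am cm)).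
    rewrite (allL a c) 1?eq_sym //; have [->|/allL->] := eqVneq a b.
      by rewrite gdist_diag //; clear; lia.
    by clear; lia.
  by case/orP: (nlinked a b ab) => /andP[na nb]; [apply: absurd zm | apply: absurd ym].
(* A contains the owner z and not y, and two linked centres on different sides
   of A are both distinct from z and y. *)
pose A (c : 'I_n + {set 'I_n}) := match c with inl j => j != i | inr Y => Y == Z end.
pose own (P : pred ('I_n + {set 'I_n})) u :=
  exists a b s, [/\ linked a b, spoke l x a b u s & P a].
have own_z : own A (x z).
  have [a [b [s [ab sp]]]] := S_spoke (S_center z).
  by exists a, b, s; split=> //; rewrite (spoke_center x_near x_mids sp) /A /z /= eqxx.
have own_y : own (predC A) (last (x z) p).
  rewrite lst; have [a [b [s [ab sp]]]] := S_spoke (S_center y).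
  by exists a, b, s; split=> //; rewrite (spoke_center x_near x_mids sp) /A /y /= eqxx.
have [|t1 [t2 [le_t1 le_t2 own1 own2 adj]]] := path_switch pth own_z own_y.
  move=> u /xpS/S_spoke[a [b [s [ab sp]]]].
  by case Aa: (A a); [left|right]; exists a, b, s; rewrite /= ?Aa.
case: own1 => a [b [s [ab sa Aa]]]; case: own2 => c [d [t [cd sc Ac]]].
have ac : a != c by apply: contraNneq Ac => <-.
have [adj_ac mid] := spoke_crossing x_near ltL sa sc adj ac.
have {adj_ac} ac_link : linked a c.
  by case: adj_ac => eq; rewrite eq // in ab cd; rewrite /linked orbC.
have [za zc ya yc] : [/\ z != a, z != c, y != a & y != c].
  move: ac_link Aa Ac ac; rewrite /linked /A /z /y.
  case: (a) (c) => [j|Y] [j'|Y'] //=; rewrite ?orbF ?negbK.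
  - move=> jj ji ij; case/negP: ji; rewrite -(eqP ij).
    by case/orP: jj => /eqP[->].
  - by move=> _ ji YZ _; split=> //; rewrite eq_sym.
  - by move=> jY eY ej; move: jY; rewrite (eqP eY) (eqP ej) (negPf iZ).
  - move=> YY /eqP eY Y'Z; case/negP: Y'Z; rewrite -eY.
    by case/orP: YY => /eqP[->].
have no_mid r : r <= size p -> far_from_others l x a c (walk_at (x z) p r) -> False.
  move=> le_r far; move: (far z r za zc (z_t r)) (far y _ ya yc (y_t r le_r)).
  by move: le_p le_r; clear; lia.
by case: mid => /no_mid; apply.
Qed.

Lemma private_mids_VC_dim : n <= distance_VC_dim G.
Proof.
have x_inj : injective x.
  move=> a b eq_ab; apply/eqP; apply: contraT => ab.
  by have := x_separated x_mids ab; rewrite eq_ab ball_center.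
pose A := [set x (inl i) | i : 'I_n].
have <- : #|A| = n by rewrite card_imset ?card_ord // => i j /x_inj[].
apply: (@leq_distance_VC_dim G S).
  by apply/subsetP=> _ /imsetP[i _ ->]; apply: S_center.
move=> Y sY; pose Z := [set i : 'I_n | x (inl i) \in Y].
exists (x (inr Z)), l.*2; split=> [|_ /imsetP[i _ ->]]; first exact: S_center.
split=> [[p [pth lst le_p pS]]|iY].
  apply: contraT => iY; have: i \notin Z by rewrite inE.
  by move/S_far => /(_ p pth lst le_p pS).
have [pth lst sz] := geodesicP (x_near (inr Z) (inl i)).
exists (geodesic (x (inr Z)) (x (inl i))); split=> //.
  by rewrite sz; case: (gdist_ball (x_near (inr Z) (inl i))).
move=> u up; rewrite inE; apply/existsP; exists (inr Z); apply/existsP; exists (inl i).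
rewrite /= inE iY; apply/existsP.
have lt_t : (index u (geodesic (x (inr Z)) (x (inl i)))).+1 < (gdist (x (inr Z)) (x (inl i))).+1.
  by rewrite ltnS -sz index_mem.
exists (Ordinal lt_t); rewrite /walk_at /=; apply/eqP.
by rewrite (take_nth u) ?index_mem // last_rcons nth_index.
Qed.

End Shattering.

(** * Heavy vertices and small covers *)

Definition config_size d := d.+1 + 2 ^ d.+1.
Definition sample_size n d :=
  2 ^ (2 ^ (config_size d + config_size d) + n.+1).
Definition concentration n d := (sample_size n d ^ 3 * 2).+1.

Lemma inj_into_set (T I : finType) (B : {set I}) :
  #|B| = #|T| -> exists2 g : T -> I, injective g & forall a, g a \in B.
Proof.
move=> eqBT; exists (fun a => enum_val (cast_ord (esym eqBT) (enum_rank a))).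
  by move=> a b /enum_val_inj/cast_ord_inj/enum_rank_inj.
by move=> a; apply: enum_valP.
Qed.

Section Concentration.
Variables (G : sgraph) (l : nat).

Lemma disjoint_balls_nu (I : finType) (x : I -> G) (B : {set I}) :
  {in B &, forall a b, a != b -> x b \notin ball (x a) l.*2} ->
  #|B| <= nu G l.
Proof.
move=> far; pose f a := ball (x a) l.
have disj a b u : a \in B -> b \in B -> u \in f a -> u \in f b -> a = b.
  move=> aB bB ua ub; apply/eqP; apply: contraT => /(far a b aB bB)/negP[].
  by rewrite -addnn; apply: ball_trans ua _; rewrite ball_sym.
have <- : #|f @: B| = #|B|.
  apply: card_in_imset => a b aB bB eq_f; apply: (disj a b (x a)) => //.
    exact: ball_center.
  by rewrite -eq_f ball_center.
apply: (@leq_bigmax_cond _ (fun P : {set {set G}} => (P \subset Bl_hypergraph G l) && trivIset P)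
  (fun P : {set {set G}} => #|P|) (f @: B)).
apply/andP; split.
  by apply/subsetP=> _ /imsetP[a _ ->]; apply: imset_f.
apply/trivIsetP=> _ _ /imsetP[a aB ->] /imsetP[b bB ->] ne.
rewrite -setI_eq0; apply/eqP/setP=> u; rewrite in_setI in_set0.
by apply: contraNF ne => /andP[ua ub]; rewrite (disj a b u).
Qed.

Lemma private_mids_sample (I : finType) (x : I -> G) :
  private_mids x l -> #|I| < sample_size (nu G l) (distance_VC_dim G).
Proof.
move=> x_mids; rewrite ltnNge; apply/negP=> leI.
set d := distance_VC_dim G in leI; pose M := config_size d.
pose e1 a b := x b \in ball (x a) l.*2.
have e1_sym : symmetric e1 by move=> a b; rewrite /e1 ball_sym.
rewrite -cardsT in leI; have [B _ [[cB near]|[cB far]]] := ramsey e1_sym leI; last first.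
  by have := disjoint_balls_nu far; rewrite cB ltnn.
pose e2 a b := e1 a b && (gdist (x a) (x b) == l.*2).
have e2_sym : symmetric e2.
  move=> a b; rewrite /e2 e1_sym; case ba: (e1 b a) => //=.
  by rewrite (gdistC ba).
have near' a b : a \in B -> b \in B -> x b \in ball (x a) l.*2.
  by move=> aB bB; have [->|/(near a b aB bB)] := eqVneq a b; first exact: ball_center.
have main (D : {set I}) : D \subset B -> #|D| = M ->
    {in D &, forall a b, a != b -> gdist (x a) (x b) = l.*2} \/
    {in D &, forall a b, a != b -> gdist (x a) (x b) < l.*2} -> False.
  move=> /subsetP sDB cD dD.
  have [|g g_inj gD] := @inj_into_set ('I_d.+1 + {set 'I_d.+1})%type _ D.
    rewrite cD card_sum card_ord -[X in _ = _ + X]cardsT -powersetT.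
    by rewrite card_powerset cardsT card_ord.
  suff: d.+1 <= d by rewrite ltnn.
  apply: (@private_mids_VC_dim G l d.+1 (x \o g)).
  - by move=> a b /=; apply: near'; apply: sDB.
  - by move=> a b m ma mb; apply: x_mids; rewrite (inj_eq g_inj).
  - by case: dD => dD; [left | right] => a b ab; apply: dD; rewrite ?(inj_eq g_inj).
have [|D DB [[cD hD]|[cD hD]]] := @ramsey _ e2 M M B e2_sym; first by rewrite cB.
  by apply: (main D DB cD); left=> a b aD bD /(hD a b aD bD)/andP[_ /eqP].
apply: (main D DB cD); right=> a b aD bD /(hD a b aD bD).
have ab := near' a b (subsetP DB a aD) (subsetP DB b bD).
rewrite /e2 /e1 ab /= ltn_neqAle => ->.
by case: (gdist_ball ab).
Qed.

Lemma concentrated_sample (W : finType) (c : W -> G) : 0 < #|W| ->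
  exists v, #|W| <= concentration (nu G l) (distance_VC_dim G) * #|[pred w | c w \in ball v l]|.
Proof.
move=> W_gt0; set b := concentration _ _; pose N := sample_size (nu G l) (distance_VC_dim G).
apply/existsP; apply: contraT; rewrite negb_exists => /forallP light; exfalso.
pose mid (s : bool) u v := if s then @lower_mid G u v else upper_mid u v.
pose E (j : 'I_N * 'I_N * 'I_N * bool) : pred {ffun 'I_N -> W} := fun f =>
  let: (i, k, m, s) := j in
  [&& m != i, m != k & c (f m) \in ball (mid s (c (f i)) (c (f k))) l].
have [|j f|f avoid] := @resampling _ W _ E (fun j => j.1.2) b W_gt0.
- by rewrite !card_prod !card_ord card_bool ltnS /N !expnS expn0 muln1 mulnA.
- case: j => [[[i k] m] s] /=.
  have [->|mi] := eqVneq m i.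
    by rewrite [X in b * X]eq_card0 ?muln0 // => w; rewrite !inE eqxx.
  have [->|mk] := eqVneq m k.
    by rewrite [X in b * X]eq_card0 ?muln0 // => w; rewrite !inE eqxx andbF.
  have := light (mid s (c (f i)) (c (f k))); rewrite -ltnNge => /ltnW; apply: leq_trans.
  rewrite leq_mul2l; apply/orP; right; apply/subset_leq_card/subsetP=> w.
  by rewrite !inE /= update_same !update_other 1?eq_sym.
have := @private_mids_sample 'I_N (c \o f); rewrite card_ord ltnn => /(_ _)/negP[] //.
move=> i k m mi mk; split.
  by have := avoid (i, k, m, true); rewrite /E mi mk.
by have := avoid (i, k, m, false); rewrite /E mi mk.
Qed.

Lemma concentrated_weight (w : G -> nat) : 0 < \sum_x w x ->
  exists v, \sum_x w x <=
    concentration (nu G l) (distance_VC_dim G) * \sum_(x in ball v l) w x.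
Proof.
have card_w (P : pred G) : #|[pred p : {x : G & 'I_(w x)} | P (tag p)]| = \sum_(x | P x) w x.
  transitivity (\sum_(x | P x) \sum_(i : 'I_(w x)) 1).
    rewrite (sig_big_dep P (fun x (i : 'I_(w x)) => true) (fun _ _ => 1)) -sum1_card.
    by apply: eq_bigl => p; rewrite inE andbT.
  by apply: eq_bigr => x _; rewrite sum1_card card_ord.
rewrite -(card_w xpredT) => /(@concentrated_sample _ tag)[v].
by rewrite (card_w (mem (ball v l))); exists v.
Qed.

End Concentration.

Lemma bernoulli k m : k ^ m * (k + m) <= k.+1 ^ m * k.
Proof.
elim: m => [|m IHm]; first by rewrite !expn0 addn0.
rewrite !expnS -!mulnA; apply: leq_trans (leq_mul (leqnn k.+1) IHm).
by move: (k ^ m) => e; clear; nia.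
Qed.

Lemma expn_gap k s : 2 ^ s * k ^ (k.+1 * s) <= k.+1 ^ (k.+1 * s).
Proof.
rewrite !expnM -expnMn; case: s => // s; rewrite leq_exp2r //.
case: k => // k; have := bernoulli k.+1 k.+2.
rewrite -[_ ^ _ * k.+1]mulnC -(leq_pmul2l (ltn0Sn k)); move: (_ ^ _) (_ ^ _) => p q.
by clear; nia.
Qed.

Section MultiplicativeWeights.
Variables (G : sgraph) (l : nat).

Lemma weighted_sequence b n : 0 < #|G| ->
  (forall w : G -> nat, 0 < \sum_x w x ->
     exists v, \sum_x w x <= b.+1 * \sum_(x in ball v l) w x) ->
  exists2 s : seq G, size s = n &
    (\sum_x 2 ^ count (fun v => v \notin ball x l) s) * b.+1 ^ n
      <= #|G| * (b.*2.+1) ^ n.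
Proof.
move=> G_gt0 heavy; elim: n => [|n [s szs le_s]].
  by exists [::] => //; rewrite !expn0 !muln1 sum1_card.
(* Doubling the weight of the balls missed at each step. *)
pose w x := 2 ^ count (fun v => v \notin ball x l) s.
have W_gt0 : 0 < \sum_x w x.
  have /card_gt0P[x0 _] := G_gt0.
  by rewrite (bigD1 x0) //= addn_gt0 /w expn_gt0.
have [v le_v] := heavy w W_gt0; exists (v :: s); first by rewrite /= szs.
set W' := \sum_x _.
have eqW : W' = \sum_(x in ball v l) w x + 2 * \sum_(x | x \notin ball v l) w x.
  rewrite /W' (bigID (mem (ball v l))) /= big_distrr /=.
  by congr (_ + _); apply: eq_bigr => x xv; rewrite /w (ball_sym x v) xv ?add0n ?add1n ?expnS.
rewrite (bigID (mem (ball v l))) /= in le_v.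
have := leq_mul le_s (leqnn b.*2.+1); rewrite -[leqRHS]mulnA -expnSr; apply: leq_trans.
rewrite expnSr mulnA mulnAC [leqRHS]mulnAC; apply: leq_mul => //.
change (W' * b.+1 <= (\sum_x w x) * b.*2.+1); rewrite (bigID (mem (ball v l))) /= eqW -muln2.
move: le_v; set p := \sum_(x in _) _; set q := \sum_(x | _) _.
by move: p q; clear; nia.
Qed.

Lemma uniform_sequence b : 0 < #|G| ->
  (forall w : G -> nat, 0 < \sum_x w x ->
     exists v, \sum_x w x <= b.+1 * \sum_(x in ball v l) w x) ->
  exists2 s : seq G, 0 < size s &
    forall x, size s <= 4 * b.+1 * count (fun v => v \in ball x l) s.
Proof.
move=> G_gt0 heavy; set N := #|G| in G_gt0.
have [s szs le_s] := weighted_sequence (b.*2.+2 * N.*2) G_gt0 heavy.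
exists s => [|x]; first by rewrite szs muln_gt0 /= double_gt0.
have := count_predC (fun v => v \in ball x l) s; set hits := count _ s.
set misses := count _ s => eq_n; rewrite szs in eq_n.
have le_x : 2 ^ misses * b.+1 ^ (b.*2.+2 * N.*2) <= N * b.*2.+1 ^ (b.*2.+2 * N.*2).
  apply: leq_trans le_s; rewrite leq_mul2r; apply/orP; right.
  by rewrite (bigD1 x) //= leq_addr.
suff: misses + N.*2 < N + (b.*2.+2 * N.*2).
  by move: eq_n; rewrite -!muln2 szs; clear; nia.
set n := b.*2.+2 * N.*2 in eq_n le_x *.
rewrite -(ltn_exp2l (m := 2)) // (expnD 2 misses) (expnD 2 N).
apply: (@leq_ltn_trans (N * 2 ^ n)); last by rewrite ltn_pmul2r ?expn_gt0 // ltn_expl.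
have gap : 2 ^ N.*2 * b.*2.+1 ^ n <= 2 ^ n * b.+1 ^ n.
  by rewrite -expnMn mul2n doubleS; apply: expn_gap.
rewrite -(@leq_pmul2r (b.*2.+1 ^ n)) ?expn_gt0 // -mulnA.
apply: leq_trans (leq_mul (leqnn _) gap) _.
by rewrite mulnCA mulnAC mulnC leq_mul2r le_x orbT.
Qed.

End MultiplicativeWeights.

Section Nets.
Variables (G : sgraph) (l b K : nat) (W : finType) (c : W -> G).
Local Notation g := (b.+1 * K.*2).
Hypothesis W_gt0 : 0 < #|W|.
Hypothesis heavy : forall x, #|W| <= b.+1 * #|[pred w | c w \in ball x l]|.
Hypothesis K_large : (K * g).+1 ^ distance_VC_dim G < 2 ^ K.

Lemma card_missing x :
  2 ^ K.*2 * #|[pred h : {ffun 'I_g -> W} | [forall t, c (h t) \notin ball x l]]|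
    <= #|{ffun 'I_g -> W}|.
Proof.
pose M := [pred w | c w \notin ball x l].
rewrite (@eq_card _ _ (ffun_on M)); last first.
  by move=> h; rewrite [LHS]inE; apply/forallP/ffun_onP => hM t; have := hM t; rewrite !inE.
rewrite card_ffun_on card_ffun card_ord.
have leM : b.+1 * #|M| <= b * #|W|.
  have <- := cardC [pred w | c w \in ball x l].
  rewrite (@eq_card _ M (predC [pred w | c w \in ball x l])); last by move=> w; rewrite !inE.
  have := heavy x; have <- := cardC [pred w | c w \in ball x l].
  by move: #|_| #|_| => p q; clear; nia.
rewrite -(@leq_pmul2l (b.+1 ^ g)) ?expn_gt0 // mulnCA -expnMn.
apply: (@leq_trans (2 ^ K.*2 * (b * #|W|) ^ g)).
  rewrite leq_mul2l; case: (g) => [|n]; first by rewrite !expn0 orbT.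
  by rewrite leq_exp2r ?leM ?orbT.
by rewrite expnMn mulnA leq_mul2r expn_gap orbT.
Qed.

Lemma small_net : exists2 A : {set G}, #|A| <= K * g &
  forall x, exists2 a, a \in A & a \in ball x l.
Proof.
have [/existsP[A /andP[leA /forallP hit]]|no_net] := boolP
    [exists A : {set G}, (#|A| <= K * g) && [forall x, [exists a in A, a \in ball x l]]].
  by exists A => // x; apply/exists_inP.
exfalso; have /card_gt0P[w0 _] := W_gt0.
(* For K random blocks of points and Y a set of blocks, a ball missing the blocks of
   Y depends on these only, so it is likely to hit every other block.  This gives
   2 ^ K traces on the sample, too many for the VC-dimension. *)
pose miss (A : {set G}) :=
  odflt (c w0) [pick x | [forall a in A, a \notin ball x l]].
have missP (A : {set G}) a : #|A| <= K * g -> a \in A -> a \notin ball (miss A) l.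
  move=> leA aA; rewrite /miss; case: pickP => [x /forall_inP|none] /=; first exact.
  case/existsP: no_net; exists A; rewrite leA; apply/forallP=> x.
  have := none x; apply: contraFT; rewrite negb_exists_in => /forall_inP h.
  by apply/forall_inP.
pose pt (f : {ffun 'I_K -> {ffun 'I_g -> W}}) (p : 'I_K * 'I_g) := c (f p.1 p.2).
pose pts f (Y : {set 'I_K}) := pt f @: [set p | p.1 \in Y].
have card_pts f Y : #|pts f Y| <= K * g.
  apply: leq_trans (leq_imset_card _ _) _; apply: leq_trans (max_card _) _.
  by rewrite card_prod !card_ord.
pose E (j : {set 'I_K} * 'I_K) : pred {ffun 'I_K -> {ffun 'I_g -> W}} := fun f =>
  (j.2 \notin j.1) && [forall t, c (f j.2 t) \notin ball (miss (pts f j.1)) l].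
have [||[Y i] f|f avoid] := @resampling _ _ _ E (fun j => j.2) (2 ^ K.*2).
- by rewrite card_ffun expn_gt0 W_gt0.
- rewrite card_prod card_ord -[X in X * _]cardsT -powersetT card_powerset cardsT card_ord.
  by rewrite -addnn expnD ltn_pmul2l ?expn_gt0 // ltn_expl.
- rewrite /E /=; have [iY|iY] := boolP (i \in Y).
    by rewrite [X in _ * X]eq_card0 ?muln0.
  apply: leq_trans (card_missing (miss (pts f Y))).
  rewrite leq_mul2l; apply/orP; right; apply/subset_leq_card/subsetP=> h.
  rewrite !inE /= update_same; congr is_true; apply: eq_forallb => t.
  congr (_ \notin ball (miss _) l); apply: eq_in_imset => p; rewrite inE => pY.
  by rewrite /pt update_other //; apply: contraNneq iY => <-.
pose F Y := [set p | pt f p \in ball (miss (pts f Y)) l].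
have F_mem (Y : {set 'I_K}) i : (i \in Y) = [forall t, (i, t) \notin F Y].
  apply/idP/forallP => [iY t|noF].
    by rewrite inE; apply: missP (card_pts f Y) _; apply: imset_f; rewrite inE.
  have := avoid (Y, i); rewrite /E /= negb_and negbK => /orP[] // /negP[].
  by apply/forallP=> t; have := noF t; rewrite inE.
have F_inj : injective F by move=> Y Z eqF; apply/setP=> i; rewrite !F_mem eqF.
pose H := [set F Y | Y : {set 'I_K}].
have cardH : #|H| = 2 ^ K.
  by rewrite card_imset // -cardsT -powersetT card_powerset cardsT card_ord.
suff shH X : shattered H X -> #|X| <= distance_VC_dim G.
  have := leq_trans (pajor H) (subset_leq_card _); rewrite cardH.
  move=> /(_ (mem [set X : {set 'I_K * 'I_g} | #|X| <= distance_VC_dim G])) le.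
  have := K_large; rewrite ltnNge => /negP[]; apply: leq_trans (le _) _.
    by apply/subsetP=> X; rewrite !inE; apply: shH.
  apply: leq_trans (card_small_sets _ _) _.
  by rewrite card_prod !card_ord.
move/shatteredP=> shX.
have pt_inj : {in X &, injective (pt f)}.
  move=> p q pX qX eq_pq; apply/eqP; apply: contraT => ne.
  have [|_ /imsetP[Y _ ->] /setP eY] := shX [set p]; first by rewrite sub1set.
  have := eY p; have := eY q; rewrite !in_setI pX qX !in_set1 eqxx !andbT.
  by rewrite eq_sym (negPf ne) [q \in _]inE [p \in _]inE eq_pq => ->.
rewrite -(card_in_imset pt_inj).
apply: (@leq_distance_VC_dim_ball _ _ l) => Z sZ.
have [|_ /imsetP[Y _ ->] /setP eY] := shX [set p in X | pt f p \in Z].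
  by apply/subsetP=> p; rewrite inE => /andP[].
exists (miss (pts f Y)) => _ /imsetP[p pX ->].
by have := eY p; rewrite in_setI pX andbT inE inE pX.
Qed.

End Nets.

Definition block_number b d := 2 ^ (d * (b.+1 * 2) + 4 * d).*2.

Lemma block_number_large b d : let K := block_number b d in
  (K * (b.+1 * K.*2)).+1 ^ d < 2 ^ K.
Proof.
rewrite /block_number /=; set z := _ + _; set K := 2 ^ z.*2.
have lt_K : d * (b.+1 * 2 + z.*2.*2) < K.
  have : z.+1 ^ 2 <= K by rewrite /K -muln2 expnM leq_exp2r // ltn_expl.
  by rewrite /z -!muln2 expnS expn1; move: K; clear; nia.
apply: leq_ltn_trans (_ : 2 ^ (d * (b.+1 * 2 + z.*2.*2)) < _); last by rewrite ltn_exp2l.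
have K2 : 2 ^ z.*2.*2 = K * K by rewrite -[in LHS]addnn expnD.
rewrite [d * _]mulnC expnM; case: (d) => [|d'] //.
rewrite leq_exp2r // expnD K2 -muln2.
have : b.+1 * 2 < 2 ^ (b.+1 * 2) by apply: ltn_expl.
have : 0 < K by rewrite expn_gt0.
by move: (2 ^ (b.+1 * 2)) K {K2 lt_K} => p k; clear; nia.
Qed.

Definition cover_number n d :=
  let b := (4 * concentration n d).-1 in
  let K := block_number b d in K * (b.+1 * K.*2).

Lemma small_cover (G : sgraph) l : exists2 A : {set G},
  #|A| <= cover_number (nu G l) (distance_VC_dim G) &
  forall x, exists2 a, a \in A & a \in ball x l.
Proof.
have [G0|G_gt0] := posnP #|G|.
  by exists set0 => [|x]; rewrite ?cards0 //; have := card0_eq G0 x.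
have [s s_gt0 hs] := uniform_sequence G_gt0 (@concentrated_weight G l).
apply: (@small_net _ l _ _ 'I_(size s) (tnth (in_tuple s))).
- by rewrite card_ord.
- move=> x; rewrite card_ord prednK; last by rewrite muln_gt0.
  apply: leq_trans (hs x) _; rewrite leq_mul2l; apply/orP; right.
  rewrite -sum1_count big_tnth -sum1_card.
  by apply/eq_leq/eq_bigl.
- exact: block_number_large.
Qed.

Theorem theorem11 :
  exists f : nat -> nat -> nat,
    forall (l d : nat) (G : sgraph),
      distance_VC_dim G = d ->
      (exists C : {set G},
         #|C| <= f (nu G l) d /\ \bigcup_(c in C) ball c l = [set: G])
      /\ tau G l <= f (nu G l) d.
Proof.
exists cover_number => l d G <-; have [A leA netA] := small_cover G l; split.
  exists A; split=> //; apply/setP=> x; rewrite in_setT; apply/bigcupP.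
  by have [a aA xa] := netA x; exists a; rewrite // ball_sym.
apply: leq_trans leA; rewrite /tau /transversality.
case: arg_minnP => [|X _]; first exact: hitting_Bl_setT.
apply; apply/forall_inP=> _ /imsetP[x _ ->]; apply/set0Pn.
by have [a aA ax] := netA x; exists a; rewrite inE ax.
Qed.
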